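(* Let $(R,\mathfrak m)$ be a Noetherian local ring such that the set $\mathrm{Tr}(R)$ of all trace ideals of $R$ is finite. Then the following hold. (a) $\dim R\le 2$, and the integral closure $\overline{R}$ of $R$ in its total ring of fractions is finitely generated as an $R$-module. (b) Let $H=\bigcup_{n>0}\left((0):_R\mathfrak m^n\right)\cong \mathrm{H}^0_{\mathfrak m}(R)$. If $\overline{R/H}$ is equi-dimensional, i.e. all maximal ideals of $\overline{R/H}$ have the same height, then $\dim R\le 1$.
   Context: All rings are commutative. For a ring $R$ and an $R$-module $M$, the trace ideal of $M$ is $\mathrm{tr}_R(M)=\sum_{f\in\operatorname{Hom}_R(M,R)}\operatorname{Im} f$. An ideal $I$ of $R$ is a trace ideal in $R$ if $I=\mathrm{tr}_R(M)$ for some $R$-module $M$ (equivalently, $I=\mathrm{tr}_R(I)$). $\mathrm{Tr}(R)$ is the set of all trace ideals in $R$. For a Noetherian ring $A$, $\overline{A}$ denotes the integral closure of $A$ in its total ring of fractions $\mathrm{Q}(A)$. *)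

(* Defs.v *)
From HB Require Import structures.
From mathcomp Require Import all_boot all_order all_algebra.
From mathcomp Require Import all_classical constructive_ereal.

Set Implicit Arguments.
Unset Strict Implicit.
Unset Printing Implicit Defensive.

Import Order.TTheory GRing.Theory Num.Theory.

Local Open Scope classical_set_scope.
Local Open Scope ring_scope.
Local Open Scope quotient_scope.

(* Rings are taken in comPzRingType, so that the zero ring is allowed: R/H
   below is the zero ring when R has dimension 0. *)

Section Ideals.
Variable R : comPzRingType.
Implicit Types I J P M : set R.

Definition is_ideal I :=
  [/\ I 0, forall x y, I x -> I y -> I (x + y) & forall a x, I x -> I (a * x)].

Definition is_prime P :=
  [/\ is_ideal P, ~ P 1 & forall x y, P (x * y) -> P x \/ P y].

Definition is_maximal M :=
  [/\ is_ideal M, ~ M 1 &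
      forall J, is_ideal J -> M `<=` J -> J = M \/ J = setT].

Definition is_local M := is_maximal M /\ forall N, is_maximal N -> N = M.

Definition noetherian := forall I, is_ideal I ->
  exists n (a : 'I_n -> R), I = [set x | exists c, x = \sum_(i < n) c i * a i].

Definition ideal_mul I J : set R :=
  [set x | exists n (a b : 'I_n -> R),
    [/\ forall i, I (a i), forall i, J (b i) & x = \sum_(i < n) a i * b i]].

Definition ideal_exp I n : set R := iter n (ideal_mul I) setT.

Definition colon I J : set R := [set x | forall y, J y -> I (x * y)].

(* A sum of submodules Im f consists of the finite sums of elements of the
   Im f; the same f may be used several times. *)
Definition trace_ideal (M : lmodType R) : set R :=
  [set x | exists n (f : 'I_n -> {linear M -> R^o}) (u : 'I_n -> M),
    x = \sum_(i < n) f i (u i)].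

Definition Tr : set (set R) :=
  [set I | exists M : lmodType R, I = trace_ideal M].

Definition prime_chain n (p : 'I_n.+1 -> set R) :=
  (forall i, is_prime (p i)) /\ (forall i j : 'I_n.+1, (i < j)%N -> p i `<` p j).

End Ideals.

Arguments noetherian : clear implicits.
Arguments Tr : clear implicits.

(* -oo when A is empty and +oo when A is unbounded, see nat_sup_leP. *)
Definition nat_sup (A : set nat) : \bar int :=
  supremum -oo%E [set (n%:Z)%:E%E | n in A].

Definition krull_dim (R : comPzRingType) : \bar int :=
  nat_sup [set n | exists p : 'I_n.+1 -> set R, prime_chain p].

Definition height (R : comPzRingType) (P : set R) : \bar int :=
  nat_sup [set n | exists p : 'I_n.+1 -> set R, prime_chain p /\ p ord_max = P].

Definition equidimensional (R : comPzRingType) :=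
  forall M N : set R, is_maximal M -> is_maximal N -> height M = height N.

Lemma nat_sup_supremums (A : set nat) :
  supremums [set (n%:Z)%:E%E | n in A] (nat_sup A).
Proof.
rewrite /nat_sup /supremum; case: ifPn => [/eqP A0|_].
  rewrite A0; split; first by move=> x [].
  by move=> x _; exact: leNye.
apply: xgetPex.
have [[b Ab]|Aunb] := pselect (exists b : nat, forall n, A n -> (n <= b)%N).
  have ex : exists b, `[< forall n, A n -> (n <= b)%N >].
    by exists b; apply/asboolP.
  have [m /asboolP Am minm] := ex_minnP ex.
  have [A0|/set0P[k Ak]] := eqVneq A set0.
    exists -oo%E; rewrite A0 image_set0; split; first by move=> x [].
    by move=> x _; exact: leNye.
  have Amm : A m.
    apply: contrapT => nAm; have m0 : (0 < m)%N.
      case: m nAm Am {minm} => // nA0 /(_ _ Ak).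
      by rewrite leqn0 => /eqP k0; rewrite k0 in Ak.
    suff : (m <= m.-1)%N by rewrite leqNgt ltn_predL m0.
    apply: minm; apply/asboolP => n An.
    rewrite -ltnS prednK// ltn_neqAle Am// andbT.
    by apply/eqP => nm; rewrite nm in An.
  exists (m%:Z)%:E%E; split.
    by move=> _ [n An <-]; rewrite lee_fin lez_nat Am.
  by move=> x /(_ (m%:Z)%:E%E); apply; exists m.
exists +oo%E; split; first by move=> x _; exact: leey.
move=> x ubx; case: x ubx => [z||] ubx.
- exfalso; apply: Aunb; exists `|z|%N => n An.
  have := ubx _ (ex_intro2 _ _ n An erefl); rewrite lee_fin => nz.
  by rewrite -lez_nat (le_trans nz)// abszE ler_norm.
- by [].
- exfalso; apply: Aunb; exists 0%N => n An.
  by have := ubx _ (ex_intro2 _ _ n An erefl).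
Qed.

Lemma nat_sup_leP (A : set nat) (x : \bar int) :
  (nat_sup A <= x)%E <-> forall n, A n -> ((n%:Z)%:E <= x)%E.
Proof.
have [ub lub] := nat_sup_supremums A; split=> [le n An|le].
  by apply: le_trans le; apply: ub; exists n.
by apply: lub => _ [n An <-]; exact: le.
Qed.

Record ideal (R : comPzRingType) :=
  Ideal { ideal_set : set R; ideal_setP : is_ideal ideal_set }.

Section QuotientRing.
Variables (R : comPzRingType) (I : ideal R).

Definition ideal_pred : R -> bool := fun x => `[< ideal_set I x >].

Lemma ideal_pred_zmod_closed : zmod_closed ideal_pred.
Proof.
have [I0 ID IM] := ideal_setP I.
split=> [|x y /asboolP Ix /asboolP Iy]; apply/asboolP => //.
by apply: ID => //; rewrite -mulN1r; exact: IM.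
Qed.

HB.instance Definition _ :=
  GRing.isZmodClosed.Build R ideal_pred ideal_pred_zmod_closed.

Definition ideal_closed : zmodClosed R := GRing.ZmodClosed.clone R ideal_pred _.

Definition quot_ring : Type := Quotient.quot ideal_closed.

HB.instance Definition _ := GRing.Zmodule.on quot_ring.

Definition to_quot (x : R) : quot_ring := \pi_(Quotient.quot ideal_closed) x.

Lemma to_quot_eq x y : to_quot x = to_quot y <-> ideal_set I (x - y).
Proof.
split=> [/eqmodP|Ixy]; first by rewrite /= Quotient.equivE => /asboolP.
by apply/eqmodP; rewrite /= Quotient.equivE; apply/asboolP.
Qed.

Lemma to_quot_surj (u : quot_ring) : exists x, to_quot x = u.
Proof. by exists (repr (u : Quotient.quot ideal_closed)); rewrite /to_quot reprK. Qed.

Lemma to_quotB : zmod_morphism to_quot.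
Proof. exact: raddfB. Qed.

HB.instance Definition _ :=
  GRing.isZmodMorphism.Build R quot_ring to_quot to_quotB.

Definition quot_repr (u : quot_ring) : R := repr (u : Quotient.quot ideal_closed).

Definition quot_mul (u v : quot_ring) : quot_ring :=
  to_quot (quot_repr u * quot_repr v).

Lemma quot_reprK u : to_quot (quot_repr u) = u.
Proof. by rewrite /to_quot reprK. Qed.

Lemma to_quotM x y : to_quot (x * y) = quot_mul (to_quot x) (to_quot y).
Proof.
have [I0 ID IM] := ideal_setP I.
apply/to_quot_eq; set x' := quot_repr _; set y' := quot_repr _.
have Ix : ideal_set I (x - x') by apply/to_quot_eq; rewrite quot_reprK.
have Iy : ideal_set I (y - y') by apply/to_quot_eq; rewrite quot_reprK.
have -> : x * y - x' * y' = y * (x - x') + x' * (y - y').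
  by rewrite !mulrBr [y * x]mulrC [y * x']mulrC addrA subrK.
by apply: ID; exact: IM.
Qed.

Lemma quot_mulA : associative quot_mul.
Proof.
move=> u v w; rewrite -[u]quot_reprK -[v]quot_reprK -[w]quot_reprK.
by rewrite -!to_quotM mulrA.
Qed.

Lemma quot_mulC : commutative quot_mul.
Proof. by move=> u v; rewrite /quot_mul mulrC. Qed.

Lemma quot_mul1 : left_id (to_quot 1) quot_mul.
Proof. by move=> u; rewrite -[u]quot_reprK -!to_quotM mul1r. Qed.

Lemma quot_mulDl : left_distributive quot_mul +%R.
Proof.
move=> u v w; rewrite -[u]quot_reprK -[v]quot_reprK -[w]quot_reprK.
by rewrite -raddfD -!to_quotM mulrDl raddfD.
Qed.

HB.instance Definition _ := GRing.Zmodule_isComPzRing.Build quot_ring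
  quot_mulA quot_mulC quot_mul1 quot_mulDl.

Lemma to_quot_monoid_morphism : monoid_morphism to_quot.
Proof. by split=> // x y; exact: to_quotM. Qed.

HB.instance Definition _ :=
  GRing.isMonoidMorphism.Build R quot_ring to_quot to_quot_monoid_morphism.

End QuotientRing.

Section TotalFractions.
Variable A : comPzRingType.

Definition regular : Type := {s : A | `[< GRing.lreg s >]}.

HB.instance Definition _ := Choice.on regular.

Lemma regularP (s : regular) : GRing.lreg (sval s).
Proof. by case: s => s /= /asboolP. Qed.

Definition reg1 : regular := exist _ 1 (introT (asboolP _) (@GRing.lreg1 A)).

Lemma regM_subproof (s t : regular) : `[< GRing.lreg (sval s * sval t) >].
Proof. by apply/asboolP; apply: GRing.lregM; exact: regularP. Qed.

Definition regM (s t : regular) : regular :=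
  exist _ (sval s * sval t) (regM_subproof s t).

Definition fraction_rel (x y : A * regular) :=
  x.1 * sval y.2 == y.1 * sval x.2.

Lemma fraction_rel_refl : reflexive fraction_rel.
Proof. by move=> x; rewrite /fraction_rel. Qed.

Lemma fraction_rel_sym : symmetric fraction_rel.
Proof. by move=> x y; rewrite /fraction_rel eq_sym. Qed.

Lemma fraction_rel_trans : transitive fraction_rel.
Proof.
move=> [b t] [a s] [c r]; rewrite /fraction_rel /= => /eqP e1 /eqP e2.
have inj : injective ( *%R (sval t)) := @regularP t.
apply/eqP; apply: inj; rewrite /= ![sval t * _]mulrC.
by rewrite mulrAC e1 mulrAC e2 mulrAC.
Qed.

Canonical fraction_equiv :=
  EquivRel fraction_rel fraction_rel_refl fraction_rel_sym fraction_rel_trans.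

Definition total_frac : Type := {eq_quot fraction_rel}.

HB.instance Definition _ := Choice.on total_frac.

Definition mk_frac (a : A) (s : regular) : total_frac :=
  \pi_{eq_quot fraction_rel} (a, s).

Definition frac_num (u : total_frac) : A :=
  (repr (u : {eq_quot fraction_rel})).1.
Definition frac_den (u : total_frac) : regular :=
  (repr (u : {eq_quot fraction_rel})).2.

Lemma mk_frac_eq a s b t :
  mk_frac a s = mk_frac b t <-> a * sval t = b * sval s.
Proof.
split=> [/eqmodP|e]; first by rewrite /= /fraction_rel /= => /eqP.
by apply/eqmodP; rewrite /= /fraction_rel /=; apply/eqP.
Qed.

Lemma mk_fracK u : mk_frac (frac_num u) (frac_den u) = u.
Proof. by rewrite /mk_frac /frac_num /frac_den -surjective_pairing reprK. Qed.

Lemma mk_fracP u : exists a s, u = mk_frac a s.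
Proof. by exists (frac_num u), (frac_den u); rewrite mk_fracK. Qed.

Definition frac_add u v := mk_frac
  (frac_num u * sval (frac_den v) + frac_num v * sval (frac_den u))
  (regM (frac_den u) (frac_den v)).
Definition frac_opp u := mk_frac (- frac_num u) (frac_den u).
Definition frac_mul u v :=
  mk_frac (frac_num u * frac_num v) (regM (frac_den u) (frac_den v)).

Lemma mk_frac_rep a s :
  frac_num (mk_frac a s) * sval s = a * sval (frac_den (mk_frac a s)).
Proof. by apply/mk_frac_eq; rewrite mk_fracK. Qed.

Lemma frac_addE a s b t : frac_add (mk_frac a s) (mk_frac b t) =
  mk_frac (a * sval t + b * sval s) (regM s t).
Proof.
apply/mk_frac_eq => /=.
have := mk_frac_rep b t; have := mk_frac_rep a s.
set a' := frac_num (mk_frac a s); set s' := sval (frac_den (mk_frac a s)).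
set b' := frac_num (mk_frac b t); set t' := sval (frac_den (mk_frac b t)).
move=> ea eb; rewrite !mulrDl; congr (_ + _).
  by rewrite mulrACA ea [t' * _]mulrC mulrACA.
by rewrite [sval s * _]mulrC mulrACA eb
  [s' * sval s]mulrC mulrACA [t' * _]mulrC.
Qed.

Lemma frac_oppE a s : frac_opp (mk_frac a s) = mk_frac (- a) s.
Proof. by apply/mk_frac_eq; rewrite !mulNr mk_frac_rep. Qed.

Lemma frac_mulE a s b t :
  frac_mul (mk_frac a s) (mk_frac b t) = mk_frac (a * b) (regM s t).
Proof. by apply/mk_frac_eq => /=; rewrite mulrACA !mk_frac_rep mulrACA. Qed.

Lemma frac_addA : associative frac_add.
Proof.
move=> u v w; rewrite -[u]mk_fracK -[v]mk_fracK -[w]mk_fracK !frac_addE.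
apply/mk_frac_eq => /=; congr (_ * _); last by rewrite mulrA.
by rewrite !mulrDl !mulrA addrA; congr (_ + _ + _); rewrite mulrAC.
Qed.

Lemma frac_addC : commutative frac_add.
Proof.
move=> u v; rewrite -[u]mk_fracK -[v]mk_fracK !frac_addE.
by apply/mk_frac_eq => /=; rewrite addrC; congr (_ * _); rewrite mulrC.
Qed.

Lemma frac_add0 : left_id (mk_frac 0 reg1) frac_add.
Proof.
move=> u; rewrite -[u]mk_fracK frac_addE; apply/mk_frac_eq => /=.
by rewrite mul0r add0r mulr1 mul1r.
Qed.

Lemma frac_addN : left_inverse (mk_frac 0 reg1) frac_opp frac_add.
Proof.
move=> u; rewrite -[u]mk_fracK frac_oppE frac_addE; apply/mk_frac_eq => /=.
by rewrite mulNr addNr !mul0r.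
Qed.

HB.instance Definition _ := GRing.isZmodule.Build total_frac
  frac_addA frac_addC frac_add0 frac_addN.

Lemma frac_mulA : associative frac_mul.
Proof.
move=> u v w; rewrite -[u]mk_fracK -[v]mk_fracK -[w]mk_fracK !frac_mulE.
by apply/mk_frac_eq => /=; rewrite !mulrA.
Qed.

Lemma frac_mulC : commutative frac_mul.
Proof.
move=> u v; rewrite -[u]mk_fracK -[v]mk_fracK !frac_mulE.
apply/mk_frac_eq => /=; congr (_ * _); exact: mulrC.
Qed.

Lemma frac_mul1 : left_id (mk_frac 1 reg1) frac_mul.
Proof.
move=> u; rewrite -[u]mk_fracK frac_mulE; apply/mk_frac_eq => /=.
by rewrite !mul1r.
Qed.

Lemma frac_mulDl : left_distributive frac_mul +%R.
Proof.
move=> u v w; rewrite -[u]mk_fracK -[v]mk_fracK -[w]mk_fracK.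
rewrite /+%R /= !(frac_addE, frac_mulE, frac_addE); apply/mk_frac_eq => /=.
set a := frac_num u; set b := frac_num v; set c := frac_num w.
set s := sval (frac_den u); set t := sval (frac_den v).
set r := sval (frac_den w).
have -> : a * c * (t * r) + b * c * (s * r) = (a * t + b * s) * c * r.
  by rewrite !mulrDl; congr (_ + _); rewrite mulrACA mulrA.
by rewrite -[RHS]mulrA; congr (_ * _); rewrite mulrACA [RHS]mulrCA -mulrA.
Qed.

HB.instance Definition _ := GRing.Zmodule_isComPzRing.Build total_frac
  frac_mulA frac_mulC frac_mul1 frac_mulDl.

Definition to_frac (a : A) : total_frac := mk_frac a reg1.

Lemma to_frac_zmod_morphism : zmod_morphism to_frac.
Proof.
move=> a b; rewrite /to_frac {2}/GRing.add {2}/GRing.opp /=.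
rewrite frac_oppE frac_addE.
by apply/mk_frac_eq => /=; rewrite !mulr1.
Qed.

HB.instance Definition _ :=
  GRing.isZmodMorphism.Build A total_frac to_frac to_frac_zmod_morphism.

Lemma to_frac_monoid_morphism : monoid_morphism to_frac.
Proof.
split=> // a b; rewrite /to_frac [RHS]frac_mulE.
by apply/mk_frac_eq => /=; rewrite !mulr1.
Qed.

HB.instance Definition _ :=
  GRing.isMonoidMorphism.Build A total_frac to_frac to_frac_monoid_morphism.

Lemma to_frac_inj : injective to_frac.
Proof. by move=> a b /mk_frac_eq /=; rewrite !mulr1. Qed.

Lemma mk_fracE a s : mk_frac a s * to_frac (sval s) = to_frac a.
Proof. by rewrite [LHS]frac_mulE; apply/mk_frac_eq => /=; rewrite !mulr1. Qed.

Lemma to_frac_unit (s : regular) : mk_frac 1 s * to_frac (sval s) = 1.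
Proof. by rewrite mk_fracE rmorph1. Qed.

End TotalFractions.

(* x is a root of the monic polynomial X^n + \sum_(i < n) c_i X^i. The library's
   integralOver asks for nonzero rings; it is equivalent there by
   integral_integralOver. *)
Definition integral (A Q : comPzRingType) (f : A -> Q) (x : Q) :=
  exists n (c : 'I_n -> A), x ^+ n + \sum_(i < n) f (c i) * x ^+ i = 0.

Lemma integral_integralOver (A Q : comNzRingType) (f : {rmorphism A -> Q}) x :
  integral f x <-> integralOver f x.
Proof.
split=> [[n [c e]]|[p pmon /rootP e]].
  pose q : {poly A} := \poly_(i < n) (if insub i is Some j then c j else 0).
  exists ('X^n + q).
    rewrite monicE lead_coefDl ?lead_coefXn// size_polyXn ltnS.
    exact: size_poly.
  apply/rootP; rewrite rmorphD /= map_polyXn hornerD hornerXn -[RHS]e.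
  congr (_ + _); rewrite (@horner_coef_wide _ n).
    apply: eq_bigr => i _; rewrite coef_map coef_poly ltn_ord.
    by rewrite valK.
  exact: leq_trans (size_poly _ _) (size_poly _ _).
have sp : (0 < size p)%N by rewrite size_poly_gt0 monic_neq0.
exists (size p).-1, (fun i => p`_i).
rewrite -[RHS]e (@horner_coef_wide _ (size p).-1.+1); last first.
  by rewrite prednK// size_poly.
rewrite big_ord_recr /= addrC coef_map.
have := pmon; rewrite monicE lead_coefE => /eqP ->; rewrite /= rmorph1 mul1r.
by congr (_ + _); apply: eq_bigr => i _; rewrite coef_map.
Qed.

Section IntegralClosure.
Variable A : comPzRingType.

Definition intclos_pred : total_frac A -> bool :=
  fun x => `[< integral (@to_frac A) x >].

Lemma intclos_subring_closed : subring_closed intclos_pred.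
Proof.
have [A0|A1] := eqVneq (1 : A) 0.
  have all_int x : x \in intclos_pred.
    apply/asboolP; exists 0%N, (fun=> 0).
    by rewrite expr0 big_ord0 addr0 -(rmorph1 (@to_frac A)) A0 rmorph0.
  by split.
have Q1 : (1 : total_frac A) != 0.
  apply: contra_neq A1 => Q0; apply: (@to_frac_inj A).
  by rewrite rmorph1 rmorph0.
pose A' : comNzRingType :=
  HB.pack (GRing.ComPzRing.sort A) (GRing.PzSemiRing_isNonZero.Build A A1).
pose Q' : comNzRingType :=
  HB.pack (total_frac A) (GRing.PzSemiRing_isNonZero.Build (total_frac A) Q1).
pose f0 : {rmorphism A -> total_frac A} := @to_frac A.
pose f : {rmorphism A' -> Q'} := f0.
have intE (x : Q') : (x \in intclos_pred) <-> integralOver f x.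
  by split=> [/asboolP /(@integral_integralOver A' Q' f)//|
              /(@integral_integralOver A' Q' f) h]; apply/asboolP.
split.
- by apply/intE; exact: integral1.
- by move=> x y /intE xi /intE yi; apply/intE; exact: (integral_sub xi yi).
- by move=> x y /intE xi /intE yi; apply/intE; exact: (integral_mul xi yi).
Qed.

Definition intclos : Type := {x : total_frac A | intclos_pred x}.

HB.instance Definition _ := SubChoice.on intclos.
HB.instance Definition _ := GRing.SubChoice_isSubComPzRing.Build
  (total_frac A) intclos_pred intclos intclos_subring_closed.

Lemma to_intclos_subproof a : intclos_pred (to_frac a).
Proof.
apply/asboolP; exists 1%N, (fun=> - a).
by rewrite big_ord1 expr0 expr1 mulr1 rmorphN subrr.
Qed.

Definition to_intclos (a : A) : intclos := exist _ (to_frac a) (to_intclos_subproof a).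

End IntegralClosure.

Definition module_finite (A B : comPzRingType) (f : A -> B) :=
  exists n (b : 'I_n -> B), forall x, exists c : 'I_n -> A,
    x = \sum_(i < n) f (c i) * b i.

Section Torsion.
Variables (R : comPzRingType) (m : set R).

Definition torsion_set : set R :=
  \bigcup_(n in [set n | (0 < n)%N]) colon [set 0] (ideal_exp m n).

Lemma ideal_mul_is_ideal I J : is_ideal J -> is_ideal (@ideal_mul R I J).
Proof.
move=> [J0 JD JM]; split.
- exists 0%N, (fun=> 0), (fun=> 0); split; [by case|by case|].
  by rewrite big_ord0.
- move=> _ _ [n [a [b [aI bJ ->]]]] [k [a' [b' [aI' bJ' ->]]]].
  exists (n + k)%N,
    (fun i : 'I_(n + k) => match fintype.split i with inl j => a j | inr j => a' j end),
    (fun i : 'I_(n + k) => match fintype.split i with inl j => b j | inr j => b' j end); split.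
  + by move=> i; case: fintype.split.
  + by move=> i; case: fintype.split.
  rewrite big_split_ord /=; congr (_ + _); apply: eq_bigr => i _.
    by rewrite -/(unsplit (inl i)) unsplitK.
  by rewrite -/(unsplit (inr i)) unsplitK.
- move=> r _ [n [a [b [aI bJ ->]]]].
  exists n, a, (fun i => r * b i); split=> //; first by move=> i; exact: JM.
  by rewrite mulr_sumr; apply: eq_bigr => i _; rewrite mulrCA.
Qed.

Lemma ideal_exp_is_ideal n : is_ideal (ideal_exp m n).
Proof. by elim: n => [|n IH]; [split|exact: ideal_mul_is_ideal]. Qed.

Lemma ideal_exp_le n k : (n <= k)%N -> ideal_exp m k `<=` ideal_exp m n.
Proof.
move=> /subnK <-; elim: (k - n)%N => // {}k IH x.
rewrite addSn => -[l [a [b [_ bJ ->]]]]; have [E0 ED EM] := ideal_exp_is_ideal n.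
by elim/big_ind: _ => // i _; apply: EM; apply: IH; exact: bJ.
Qed.

Lemma torsion_set_is_ideal : is_ideal torsion_set.
Proof.
split.
- by exists 1%N => //= y _; rewrite /= mul0r.
- move=> x y [n n0 xn] [k k0 yk]; exists (maxn n k) => /=.
    by rewrite leq_max n0.
  move=> z zm; rewrite /= mulrDl.
  by rewrite (xn z) ?(yk z) ?addr0//; apply: ideal_exp_le zm;
    rewrite ?leq_maxl ?leq_maxr.
- by move=> a x [n n0 xn]; exists n => // y ym; rewrite /= -mulrA (xn y)// mulr0.
Qed.

Definition torsion : ideal R := Ideal torsion_set_is_ideal.

End Torsion.

(* Main.v *)
Require Import Defs.
From HB Require Import structures.
From mathcomp Require Import all_boot all_order all_algebra.
From mathcomp Require Import all_classical constructive_ereal.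
From mathcomp Require Import ring.

(** The theorem holds because a Noetherian ring with finitely many trace ideals
    has an integral closure that is finite over it and has dimension at most
    one; the dimension bounds of both parts follow from the latter.

    An ideal I is a trace ideal exactly when every homomorphism from I to the
    ring has its values in I (TrP). If I contains a regular element, the
    homomorphisms are multiplications by fractions, and the condition becomes
    A : I = I : I inside the total ring of fractions (Tr_frac).

    Finiteness of the integral closure: for an integral fraction x, the
    conductor A : A[x] is a regular trace ideal. Finitely many of these occur,
    so a product of regular elements chosen in each of them is one regular
    denominator for all integral fractions (common_denominator), and the
    integral closure is isomorphic to an ideal of A (intclos_module_finite).

    Dimension: let P < P' be primes of A, with P containing a regular element.
    Choose a prime q of the integral closure B over P (lying_over), an element
    t of P' outside P, and put M = q + t B, a proper ideal. If y M lies in B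
    then y q lies in q, because q is prime and t is not in q; as q is regular,
    y is integral (almost_integral). Thus B : M = B. For the conductor C of B
    in A one has A : C = B, whence A : M^n C = B for all n. The M^n C are ideals
    of B, so they are trace ideals of A, and by nakayama they decrease strictly
    (Tr_infinite). So finitely many trace ideals forbid such a pair of primes.

    A chain p0 < p1 < p2 in R is brought into this situation by passing to the
    image of R in its localization at p0, where everything outside p0 becomes
    regular. Preimages of trace ideals under this quotient map are trace ideals
    (Tr_preimage), so finiteness is inherited. *)

Set Implicit Arguments.
Unset Strict Implicit.

Import Order.TTheory GRing.Theory Num.Theory.

Local Open Scope ring_scope.

(** * Ideals and functions that are linear on them *)

Section Ideals.
Local Open Scope classical_set_scope.
Variable A : comPzRingType.
Implicit Types (I J : set A) (g : A -> A).

Lemma ideal_sum I n (c : 'I_n -> A) a : is_ideal I -> (forall i, I (a i)) ->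
  I (\sum_(i < n) c i * a i).
Proof. by move=> [I0 ID IM] Ia; elim/big_ind: _ => // i _; apply: IM. Qed.

Lemma ideal_sub I x y : is_ideal I -> I x -> I y -> I (x - y).
Proof.
by move=> [_ ID IM] Ix Iy; apply: ID => //; rewrite -mulN1r; apply: IM.
Qed.

Lemma generator_mem I n (a : 'I_n -> A) i :
  I = [set x | exists c, x = \sum_(j < n) c j * a j] -> I (a i).
Proof.
move=> ->; exists (fun j => (j == i)%:R).
by rewrite (bigD1 i)//= eqxx mul1r big1 ?addr0// => j /negPf ->; rewrite mul0r.
Qed.

(** The union of the chain is finitely generated, so one member of the chain
    already contains all the generators. *)
Lemma noetherian_acc (E : nat -> set A) : noetherian A ->
  (forall n, is_ideal (E n)) -> {homo E : m n / (m <= n)%N >-> m `<=` n} ->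
  exists N, forall n, E n `<=` E N.
Proof.
move=> noeA Eid Ele; have Uid : is_ideal (\bigcup_n E n).
  split; first by exists 0%N => //; case: (Eid 0%N).
  - move=> x y [i _ xi] [j _ yj]; exists (maxn i j) => //.
    case: (Eid (maxn i j)) => _ ED _.
    by apply: ED; [apply: Ele xi; apply: leq_maxl|apply: Ele yj; apply: leq_maxr].
  - by move=> a x [i _ xi]; exists i => //; case: (Eid i) => _ _; apply.
have [k [a Ua]] := noeA _ Uid.
have aU i : exists n, E n (a i).
  suff [n _ ain] : (\bigcup_n E n) (a i) by exists n.
  exact: generator_mem Ua.
have /choice[N EN] := aU; exists (\max_i N i) => n x xn.
have : (\bigcup_n E n) x by exists n.
rewrite Ua => -[c ->]; apply: ideal_sum => // i.
by apply: Ele (EN i); apply: leq_bigmax.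
Qed.

(** A homomorphism from an ideal to the ring is encoded as a function on the
    whole ring, so that composing, restricting and descending homomorphisms
    involves no subtype. *)
Definition linear_on I g :=
  forall a x y, I x -> I y -> g (a * x + y) = a * g x + g y.

Lemma linear_on0 I g : is_ideal I -> linear_on I g -> g 0 = 0.
Proof.
move=> [I0 _ _] gl; have := gl 1 0 0 I0 I0.
by rewrite mul1r addr0 mul1r => /esym/(canRL (addrK _)); rewrite subrr.
Qed.

Lemma linear_onM I g a x : is_ideal I -> linear_on I g -> I x ->
  g (a * x) = a * g x.
Proof.
move=> Iid gl Ix; have [I0 _ _] := Iid.
by rewrite -[a * x]addr0 gl// (linear_on0 Iid gl) addr0.
Qed.

Lemma linear_onB I g x y : is_ideal I -> linear_on I g -> I x -> I y ->
  g (x - y) = g x - g y.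
Proof. by move=> Iid gl Ix Iy; rewrite addrC -mulN1r gl// mulN1r addrC. Qed.

End Ideals.

(** * Trace ideals as ideals stable under their homomorphisms to the ring *)

Section IdealModule.
Variables (A : comPzRingType) (I : ideal A).

Lemma ideal_pred_submod_closed : submod_closed (ideal_pred I : pred A^o).
Proof.
have [I0 ID IM] := ideal_setP I; split; first exact/asboolP.
move=> a x y /asboolP Ix /asboolP Iy; apply/asboolP.
by apply: ID => //; apply: IM.
Qed.

Definition ideal_module : Type := {x : A^o | ideal_pred I x}.

HB.instance Definition _ := SubChoice.on ideal_module.
HB.instance Definition _ := GRing.SubChoice_isSubLmodule.Build
  A A^o (ideal_pred I) ideal_module ideal_pred_submod_closed.

End IdealModule.

Section TraceIdeals.
Local Open Scope classical_set_scope.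
Variable A : comPzRingType.
Implicit Types (I J : set A) (g : A -> A).

(** Composing a homomorphism from a trace ideal to the ring with those from the
    module gives homomorphisms from the module again, so the values remain in
    the trace ideal. Conversely, a stable ideal is its own trace: the inclusion
    gives one containment, stability the other. *)
Lemma TrP I :
  Tr A I <-> is_ideal I /\ forall g, linear_on I g -> forall x, I x -> I (g x).
Proof.
split=> [[M ->]|[Iid Ist]].
  have Tid : is_ideal (trace_ideal M).
    split.
    - by exists 0%N, (fun=> \0), (fun=> 0); rewrite big_ord0.
    - move=> _ _ [n [f [u ->]]] [k [f' [u' ->]]].
      exists (n + k)%N,
        (fun i => match fintype.split i with inl j => f j | inr j => f' j end),
        (fun i => match fintype.split i with inl j => u j | inr j => u' j end).
      rewrite big_split_ord /=; congr (_ + _); apply: eq_bigr => i _.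
        by rewrite -/(unsplit (inl i)) unsplitK.
      by rewrite -/(unsplit (inr i)) unsplitK.
    - move=> a _ [n [f [u ->]]]; exists n, f, (fun i => a *: u i).
      by rewrite mulr_sumr; apply: eq_bigr => i _; rewrite linearZ.
  split=> // g gl _ [n [f [u ->]]].
  have Tf (h : {linear M -> A^o}) v : trace_ideal M (h v).
    by exists 1%N, (fun=> h), (fun=> v); rewrite big_ord1.
  have [T0 TD TM] := Tid.
  have gf i : linear ((g \o f i) : M -> A^o).
    by move=> a v w /=; rewrite linearP gl.
  pose gfl i : {linear M -> A^o} :=
    HB.pack (g \o f i : M -> A^o) (GRing.isLinear.Build A M A^o _ _ (gf i)).
  exists n, gfl, u => /=.
  elim: n f u {gf gfl} => [|n IHn] f u.
    by rewrite !big_ord0 (linear_on0 Tid gl).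
  rewrite !big_ord_recl -[X in g (X + _)]mul1r gl ?mul1r ?IHn//.
  by elim/big_ind: _ => // *; apply: Tf.
pose I' := Ideal Iid; exists (ideal_module I').
apply/seteqP; split=> [x Ix|_ [n [f [u ->]]]].
  have xI : ideal_pred I' x by apply/asboolP.
  exists 1%N, (fun=> \val : {linear ideal_module I' -> A^o}).
  by exists (fun=> exist _ x xI); rewrite big_ord1.
have [I0 ID _] := Iid; elim/big_ind: _ => // i _.
(* A homomorphism on the ideal is extended by 0 to a function on the ring. *)
pose g x := if insub x is Some v then f i v : A else 0.
have gE v : g (val v) = f i v by rewrite /g valK.
have Ival (v : ideal_module I') : I (val v).
  by have : ideal_pred I' (val v) := valP v; move=> /asboolP.
rewrite -gE; apply: Ist; last exact: Ival.
move=> a x y Ix Iy.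
have xI : ideal_pred I' x by apply/asboolP.
have yI : ideal_pred I' y by apply/asboolP.
pose v : ideal_module I' := exist _ x xI.
pose w : ideal_module I' := exist _ y yI.
have -> : a * x + y = val (a *: v + w) by rewrite linearP.
by rewrite gE linearP -!gE.
Qed.

End TraceIdeals.

(** * Trace ideals and integrality in the total ring of fractions *)

Section Fractions.
Local Open Scope classical_set_scope.
Variable A : comPzRingType.
Notation Q := (total_frac A).
Notation emb := (@to_frac A).
Implicit Types (I : set A) (J : set Q) (q x y z : Q).

Definition in_base q := exists a, q = emb a.

Lemma in_baseD x y : in_base x -> in_base y -> in_base (x + y).
Proof. by move=> [a ->] [b ->]; exists (a + b); rewrite rmorphD. Qed.

Lemma in_baseM x y : in_base x -> in_base y -> in_base (x * y).
Proof. by move=> [a ->] [b ->]; exists (a * b); rewrite rmorphM. Qed.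

Lemma frac_regI s : GRing.lreg s -> injective ( *%R (emb s)).
Proof.
move=> sreg; have /asboolP sr := sreg.
apply: (can_inj (g := *%R (mk_frac 1 (exist _ s sr)))) => x /=.
by rewrite mulrA (to_frac_unit (exist _ s sr)) mul1r.
Qed.

Lemma frac_denom q : exists s a, GRing.lreg s /\ emb s * q = emb a.
Proof.
have [a [s ->]] := mk_fracP q; exists (sval s), a; split.
  exact: regularP.
by rewrite mulrC mk_fracE.
Qed.

(** A homomorphism g on an ideal containing a regular element s is
    multiplication by the fraction g(s)/s, because s g(a) = g(s a) = a g(s).
    Hence such an ideal I is a trace ideal as soon as A : I is contained in
    I : I. *)
Lemma Tr_frac I s : is_ideal I -> I s -> GRing.lreg s ->
  (forall q, (forall a, I a -> in_base (q * emb a)) ->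
     forall a, I a -> exists2 b, I b & q * emb a = emb b) ->
  Tr A I.
Proof.
move=> Iid Is sreg Iq; apply/TrP; split=> // g gl a Ia.
have sr : `[< GRing.lreg s >] by apply/asboolP.
have qE b : I b -> mk_frac (g s) (exist _ s sr) * emb b = emb (g b).
  move=> Ib; apply: (frac_regI sreg); rewrite mulrA [emb s * _]mulrC.
  rewrite (mk_fracE (g s) (exist _ s sr)) -!rmorphM; congr emb.
  by rewrite -(linear_onM _ Iid gl Ib) [s * b]mulrC (linear_onM _ Iid gl Is) mulrC.
have [|b Ib] := Iq (mk_frac (g s) (exist _ s sr)) _ a Ia.
  by move=> b Ib; exists (g b); rewrite qE.
by rewrite qE// => /to_frac_inj ->.
Qed.

Lemma integral_one : integral emb (1 : Q).
Proof. by have [/asboolP] := intclos_subring_closed A. Qed.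

Lemma integralB x y : integral emb x -> integral emb y -> integral emb (x - y).
Proof.
have [_ sub _] := intclos_subring_closed A => /asboolP xi /asboolP yi.
by apply/asboolP; exact: (sub x y).
Qed.

Lemma integralM x y : integral emb x -> integral emb y -> integral emb (x * y).
Proof.
have [_ _ mul] := intclos_subring_closed A => /asboolP xi /asboolP yi.
by apply/asboolP; exact: (mul x y).
Qed.

Lemma integralD x y : integral emb x -> integral emb y -> integral emb (x + y).
Proof.
move=> xi yi; rewrite -[y]opprK; apply: integralB => //.
rewrite -sub0r; apply: integralB => //; rewrite -(subrr 1).
by apply: integralB; apply: integral_one.
Qed.

Lemma integral_base a : integral emb (emb a).
Proof. exact/asboolP/to_intclos_subproof. Qed.

(** The ideals of those elements of A that are A-combinations of
    s, s q, ..., s q^(n-1) form an ascending chain. Once it is stationary,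
    s q^n is a combination of the lower terms, and s cancels. This replaces
    the determinant trick wherever a fraction is to be shown integral. *)
Lemma almost_integral s q : noetherian A -> GRing.lreg s ->
  (forall k, in_base (emb s * q ^+ k)) -> integral emb q.
Proof.
move=> noeA sreg sq.
pose E n : set A := [set a | exists c : nat -> A,
  emb a = emb s * \sum_(i < n) emb (c i) * q ^+ i].
have Eid n : is_ideal (E n).
  split.
  - exists (fun=> 0); rewrite big1 ?mulr0 ?rmorph0// => i _.
    by rewrite mul0r.
  - move=> a b [c ac] [d bd]; exists (fun i => c i + d i).
    rewrite rmorphD /= ac bd -mulrDr -big_split; congr (_ * _).
    by apply: eq_bigr => i _; rewrite rmorphD mulrDl.
  - move=> r a [c ac]; exists (fun i => r * c i).
    rewrite rmorphM /= ac mulrCA mulr_sumr; congr (_ * _).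
    by apply: eq_bigr => i _; rewrite rmorphM mulrA.
have Ele : {homo E : m n / (m <= n)%N >-> m `<=` n}.
  move=> m n mn a [c ac]; exists (fun i => if (i < m)%N then c i else 0).
  rewrite ac (big_ord_widen n (fun i => emb (c i) * q ^+ i) mn) big_mkcond.
  by congr (_ * _); apply: eq_bigr => i _; case: ifP; rewrite ?rmorph0 ?mul0r.
have [N EN] := noetherian_acc noeA Eid Ele.
have [a aE] := sq N.
have [|c] := EN N.+1 a.
  exists (fun i => (i == N)%:R); rewrite -aE big_ord_recr /= eqxx rmorph1 mul1r.
  rewrite big1 ?add0r// => i _.
  by rewrite (ltn_eqF (ltn_ord i)) rmorph0 mul0r.
rewrite -aE => /(frac_regI sreg) qN; exists N, (fun i => - c i).
rewrite qN -big_split big1// => i _.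
by rewrite rmorphN mulNr /= subrr.
Qed.

(** The conductor A : A[x], described without forming A[x]. *)
Definition power_conductor x : set A :=
  [set a | forall k, in_base (emb a * x ^+ k)].

Lemma power_conductor_ideal x : is_ideal (power_conductor x).
Proof.
split.
- by move=> k; exists 0; rewrite rmorph0 mul0r.
- by move=> a b ax bx k; rewrite rmorphD mulrDl; apply: in_baseD.
- by move=> r a ax k; rewrite rmorphM -mulrA; apply: in_baseM => //; exists r.
Qed.

(** If x = a/s satisfies a monic equation of degree n, then s^n is a common
    denominator of the powers of x below n, and hence of all of them. *)
Lemma power_conductor_reg x : integral emb x ->
  exists2 s, GRing.lreg s & power_conductor x s.
Proof.
move=> [n [c xn]]; have [s [a [sreg sx]]] := frac_denom x.
exists (s ^+ n); first exact: GRing.lregX.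
have xnE k : x ^+ (n + k) = \sum_(i < n) emb (- c i) * x ^+ (i + k).
  rewrite exprD; move/(canRL (addrK _)): xn => ->.
  rewrite sub0r mulNr mulr_suml -sumrN; apply: eq_bigr => i _.
  by rewrite rmorphN mulNr exprD mulrA.
elim/ltn_ind => k IHk; have [kn|nk] := leqP k n.
  (* Low powers: s^n x^k = s^(n-k) a^k; higher ones reduce by the equation. *)
  exists (s ^+ (n - k) * a ^+ k).
  by rewrite -{1}(subnK kn) exprD !rmorphM -mulrA !rmorphXn /= -sx exprMn.
rewrite -(subnKC (ltnW nk)) xnE mulr_sumr; elim/big_ind: _.
- by exists 0; rewrite rmorph0.
- exact: in_baseD.
- move=> i _; rewrite mulrCA; apply: in_baseM; first by eexists.
  by apply: IHk; rewrite -[ltnRHS](subnKC (ltnW nk)) ltn_add2r.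
Qed.

(** If q sends the conductor into A, then it sends it into itself, since the
    conductor is closed under multiplication by x. *)
Lemma power_conductor_Tr x : integral emb x -> Tr A (power_conductor x).
Proof.
move=> xi; have [s sreg sx] := power_conductor_reg xi.
apply: (Tr_frac _ sx) => // [|q qx a ax]; first exact: power_conductor_ideal.
have [b bE] := qx a ax; exists b => // k.
have [d dE] := ax k; rewrite -bE -mulrA dE; apply: qx => j.
by rewrite -dE -mulrA -exprD; apply: ax.
Qed.

(** This is where finiteness of the set of trace ideals makes the integral
    closure small: only finitely many conductors A : A[x] occur, each contains
    a regular element, and the product of such elements lies in all of them. *)
Lemma common_denominator : finite_set (Tr A) ->
  exists2 s, GRing.lreg s & forall x, integral emb x -> in_base (emb s * x).
Proof.
move=> /finite_seqP[ss TrE].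
have [s sreg sss] : exists2 s, GRing.lreg s & forall I, I \in ss ->
    is_ideal I -> (exists2 r, GRing.lreg r & I r) -> I s.
  elim: {TrE} ss => [|I ss [s sreg IHs]].
    by exists 1 => //; exact: GRing.lreg1.
  have [[Iid [r rreg Ir]]|nI] :=
    pselect (is_ideal I /\ exists2 r, GRing.lreg r & I r).
    exists (r * s) => [|J]; first exact: GRing.lregM.
    rewrite inE => /predU1P[->|Jss] Jid Jr.
      by rewrite mulrC; case: Iid => _ _; apply.
    by case: (Jid) => _ _; apply; apply: IHs.
  exists s => // J; rewrite inE => /predU1P[->|/IHs//] Iid Ir.
  by case: nI.
exists s => // x xi; have := sss (power_conductor x).
suff Iss : power_conductor x \in ss.
  move=> /(_ Iss (power_conductor_ideal x) (power_conductor_reg xi)) /(_ 1%N).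
  by rewrite expr1.
have := power_conductor_Tr xi; rewrite TrE; exact.
Qed.

(** With a common denominator s, the integral closure is isomorphic to the
    ideal s * intclos of the Noetherian ring. *)
Lemma intclos_module_finite : noetherian A -> finite_set (Tr A) ->
  module_finite (@to_intclos A).
Proof.
move=> noeA /common_denominator[s sreg sB].
pose E : set A := [set a | exists2 b, integral emb b & emb a = emb s * b].
have Eid : is_ideal E.
  split.
  - exists 0; last by rewrite mulr0 rmorph0.
    by rewrite -(rmorph0 emb); apply: integral_base.
  - move=> x y [b bi xb] [c ci yc]; exists (b + c); first exact: integralD.
    by rewrite rmorphD /= xb yc mulrDr.
  - move=> r x [b bi xb]; exists (emb r * b).
      by apply: integralM => //; apply: integral_base.
    by rewrite rmorphM /= xb mulrCA.
have [n [a Ea]] := noeA _ Eid.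
have aE i : exists b : intclos A, emb (a i) = emb s * val b.
  have [b /asboolP bi ab] : E (a i) by exact: generator_mem Ea.
  by exists (exist _ b bi).
have /choice[b bE] := aE; exists n, b => x.
have /asboolP xi : intclos_pred (val x) := valP x.
have [d dE] := sB _ xi.
have : E d by exists (val x).
rewrite Ea => -[c dc]; exists c; apply/val_inj/(frac_regI sreg).
rewrite dE dc !rmorph_sum mulr_sumr; apply: eq_bigr => i _.
by rewrite !rmorphM /= bE mulrCA.
Qed.

(** * Submodules over the integral closure *)

(** Submodules over the integral closure are subsets of the total ring of
    fractions, so that they, their colons and ideals of the base ring can be
    compared without coercions. *)
Definition bmodule (J : set Q) := [/\ J 0, forall x y, J x -> J y -> J (x + y) &
  forall b x, integral emb b -> J x -> J (b * x)].

Lemma bmoduleN J x : bmodule J -> J x -> J (- x).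
Proof.
move=> [_ _ JM] Jx; rewrite -mulN1r; apply: JM => //.
rewrite -(rmorph1 emb) -rmorphN; exact: integral_base.
Qed.

Lemma bmoduleB J x y : bmodule J -> J x -> J y -> J (x - y).
Proof. by move=> Jmod Jx /(bmoduleN Jmod); case: Jmod => _ JD _; apply: JD. Qed.

Lemma integralX x n : integral emb x -> integral emb (x ^+ n).
Proof.
move=> xi; elim: n => [|n IHn]; first exact: integral_one.
by rewrite exprS; apply: integralM.
Qed.

Lemma bmodule_subX J x y n : bmodule J -> integral emb x -> integral emb y ->
  J (x - y) -> J (x ^+ n - y ^+ n).
Proof.
move=> [J0 JD JM] xi yi Jxy; elim: n => [|n IHn]; first by rewrite !expr0 subrr.
have -> : x ^+ n.+1 - y ^+ n.+1 = x * (x ^+ n - y ^+ n) + y ^+ n * (x - y).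
  by rewrite !exprS; ring.
by apply: JD; apply: JM => //; apply: integralX.
Qed.

(** In the integral closure modulo J, s is the multiple t b. Multiplying a monic
    equation of b by a power of t gives a monic equation of t b whose lower
    coefficients are multiples of t in the base ring; substituting s yields an
    element of the base ring in J that is a power of s modulo t. *)
Lemma integral_contract (J : set Q) b s t : bmodule J -> integral emb b ->
  J (emb s - emb t * b) -> exists n c, J (emb (s ^+ n + t * c)).
Proof.
move=> Jmod bi Jst; have [J0 JD JM] := Jmod.
have [n [c bn]] := bi; exists n, (\sum_(i < n) c i * t ^+ (n - i.+1) * s ^+ i).
set y := emb t * b in Jst.
have yi : integral emb y by apply: integralM => //; apply: integral_base.
have si : integral emb (emb s) by apply: integral_base.
have JX k : J (emb s ^+ k - y ^+ k) by apply: bmodule_subX.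
have -> : emb (s ^+ n + t * \sum_(i < n) c i * t ^+ (n - i.+1) * s ^+ i) =
    (emb s ^+ n - y ^+ n) +
    \sum_(i < n) emb (c i * t ^+ (n - i)) * (emb s ^+ i - y ^+ i).
  have yn : y ^+ n + \sum_(i < n) emb (c i * t ^+ (n - i)) * y ^+ i = 0.
    have := congr1 ( *%R (emb t ^+ n)) bn; rewrite mulr0 mulrDr -exprMn.
    apply: etrans; rewrite mulr_sumr.
    congr (_ + _). apply: eq_bigr => i _.
    rewrite (_ : emb t ^+ n = emb t ^+ (n - i) * emb t ^+ i); last first.
      by rewrite -exprD subnK// ltnW.
    rewrite exprMn rmorphM rmorphXn /=.
    ring.
  have tE : emb (t * \sum_(i < n) c i * t ^+ (n - i.+1) * s ^+ i) =
      \sum_(i < n) emb (c i * t ^+ (n - i)) * emb s ^+ i.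
    rewrite mulr_sumr rmorph_sum; apply: eq_bigr => i _ /=.
    have -> : (n - i = (n - i.+1).+1)%N by rewrite -subSn.
    by rewrite !(rmorphM, rmorphXn) /= exprS; ring.
  rewrite rmorphD rmorphXn /= tE; under [in RHS]eq_bigr do rewrite mulrBr.
  by rewrite sumrB (canRL (addrK _) yn); ring.
apply: (JD); first exact: JX.
apply: (big_ind J) => // i _; apply: JM => //.
exact: integral_base.
Qed.

Definition adjoin (J : set Q) y : set Q :=
  [set x | exists2 b, integral emb b & J (x - y * b)].

Lemma integral_zero : integral emb 0.
Proof. by rewrite -(rmorph0 emb); apply: integral_base. Qed.

Lemma adjoin_bmodule (J : set Q) y : bmodule J -> bmodule (adjoin J y).
Proof.
move=> [J0 JD JM]; split.
- by exists 0; [exact: integral_zero|rewrite mulr0 subr0].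
- move=> x z [b bi Jx] [c ci Jz]; exists (b + c); first exact: integralD.
  by rewrite mulrDr opprD addrACA; apply: JD.
- move=> a x ai [b bi Jx]; exists (a * b); first exact: integralM.
  by rewrite mulrCA -mulrBr; apply: JM.
Qed.

Lemma sub_adjoin (J : set Q) y : J `<=` adjoin J y.
Proof.
by move=> x Jx; exists 0; [exact: integral_zero|rewrite mulr0 subr0].
Qed.

Lemma adjoin_mem (J : set Q) y : bmodule J -> adjoin J y y.
Proof.
by move=> [J0 _ _]; exists 1; [exact: integral_one|rewrite mulr1 subrr].
Qed.

Lemma adjoin_integral (J : set Q) y : J `<=` integral emb -> integral emb y ->
  adjoin J y `<=` integral emb.
Proof.
move=> Ji yi x [b bi /Ji xi]; rewrite -(subrK (y * b) x).
by apply: integralD => //; apply: integralM.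
Qed.

(** q is maximal among the submodules of the integral closure whose contraction
    lies in P. Primality and equality of the contraction with P follow from
    maximality: adjoining any y outside q produces an element s outside P with
    s congruent to a multiple of y modulo q. *)
Lemma lying_over (P : set A) : is_prime P -> exists q : set Q,
  [/\ bmodule q, q `<=` integral emb, forall a, q (emb a) <-> P a &
      forall y z, integral emb y -> integral emb z -> q (y * z) -> q y \/ q z].
Proof.
move=> [[P0 PD PM] P1 Ppr].
pose C (K : set Q) :=
  [/\ bmodule K, K `<=` integral emb & forall a, K (emb a) -> P a].
have C0 : C [set 0].
  split.
  - split=> [//|x y -> ->|b x _ ->]; first by rewrite addr0.
    by rewrite mulr0.
  - by move=> _ ->; exact: integral_zero.
  - by move=> a; rewrite -(rmorph0 emb) => /to_frac_inj ->.
(* The union of the empty chain is empty, so the empty set has to be admitted. *)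
have [F FC Ftot|q [qC qmax]] := @Zorn_bigcup Q [set K | K = set0 \/ C K].
  have CF K x : F K -> K x -> C K by move=> /FC[->|].
  have [->|/set0P[x0 [K0 FK0 K0x0]]] := eqVneq (\bigcup_(X in F) X) set0.
    by left.
  right; split.
  - split.
    + by exists K0 => //; have [[]] := CF _ _ FK0 K0x0.
    + move=> x y [K FK Kx] [L FL Ly].
      have [KL|LK] := Ftot _ _ FK FL.
        exists L => //; have [[_ LD _] _ _] := CF _ _ FL Ly.
        by apply: LD => //; apply: KL.
      exists K => //; have [[_ KD _] _ _] := CF _ _ FK Kx.
      by apply: KD => //; apply: LK.
    + move=> b x bi [K FK Kx]; exists K => //.
      by have [[_ _ KM] _ _] := CF _ _ FK Kx; apply: KM.
  - by move=> x [K FK Kx]; have [_ Ki _] := CF _ _ FK Kx; apply: Ki.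
  - by move=> a [K FK Kx]; have [_ _ KP] := CF _ _ FK Kx; apply: KP.
have {qC}[qmod qi qP] : C q.
  case: qC => // q0; case: (qmax [set 0]); last by right.
  by rewrite q0; split=> // /(_ 0); apply.
have [q0 qD qM] := qmod.
have out y : integral emb y -> ~ q y ->
    exists a b, [/\ integral emb b, ~ P a & q (emb a - y * b)].
  move=> yi qy; apply: contrapT => noa.
  apply: (qmax (adjoin q y)).
    split; first exact: sub_adjoin.
    by move=> /(_ _ (adjoin_mem _ qmod)).
  right; split; [exact: adjoin_bmodule|exact: adjoin_integral|].
  move=> a [b bi qa]; apply: contrapT => Pa; apply: noa.
  by exists a, b.
exists q; split=> //.
  move=> a; split=> [/qP//|Pa]; apply: contrapT => qa.
  have [s [b [bi Ps qs]]] := out _ (integral_base a) qa.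
  have [n [c /qP]] := integral_contract qmod bi qs.
  move=> /(PD _ (- c * a)) /(_ (PM _ _ Pa)); rewrite mulNr mulrC addrK.
  elim: n {qs} => [|n IHn]; first by rewrite expr0.
  by rewrite exprS => /Ppr[].
move=> y z yi zi qyz; apply: contrapT => /not_orP[qy qz].
have [s [b [bi Ps qs]]] := out _ yi qy.
have [t [c [ci Pt qt]]] := out _ zi qz.
suff /qP/Ppr[] : q (emb (s * t)) by [].
have -> : emb (s * t) = emb t * (emb s - y * b) + (y * b) * (emb t - z * c) +
    (b * c) * (y * z) by rewrite rmorphM /=; ring.
apply: (qD); last by apply: (qM) => //; apply: integralM.
apply: (qD); apply: (qM) => //; first exact: integral_base.
exact: integralM.
Qed.

(** The submodule generated by the products, as the smallest additive submonoid
    containing them; elements are then used by instantiating K. *)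
Definition mulmod (M I : set Q) : set Q := [set x | forall K : set Q,
  K 0 -> (forall y z, K y -> K z -> K (y + z)) ->
  (forall y z, M y -> I z -> K (y * z)) -> K x].

Lemma mulmod_mul (M I : set Q) y z : M y -> I z -> mulmod M I (y * z).
Proof. by move=> My Iz K _ _; apply. Qed.

Lemma mulmod_sub (M I J : set Q) : bmodule J ->
  (forall y z, M y -> I z -> J (y * z)) -> mulmod M I `<=` J.
Proof. by move=> [J0 JD _] MIJ x /(_ J); apply. Qed.

Lemma mulmod_bmodule (M I : set Q) : bmodule M -> bmodule (mulmod M I).
Proof.
move=> [_ _ MM]; split; first by move=> K.
  by move=> x y MIx MIy K K0 KD KM; apply: (KD); [apply: MIx|apply: MIy].
move=> b x bi /(_ [set z | mulmod M I (b * z)]); apply => /=.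
- by rewrite mulr0 => K.
- move=> y z MIy MIz; rewrite mulrDr => K K0 KD KM.
  by apply: (KD); [apply: MIy|apply: MIz].
- by move=> y z My Iz; rewrite mulrA; apply: mulmod_mul => //; apply: MM.
Qed.

(** Nakayama's lemma with respect to an arbitrary ideal M. One generator
    is eliminated at a time: its equation gives (1 - y) x_0 in the span of the
    others, and multiplying their equations by 1 - y removes x_0 from them. *)
Lemma nakayama (M : set Q) n (x : 'I_n -> Q) :
  bmodule M -> M `<=` integral emb ->
  (forall i, exists2 N : 'I_n -> Q, (forall j, M (N j)) &
     x i = \sum_(j < n) N j * x j) ->
  exists2 a, M a & forall i, (1 - a) * x i = 0.
Proof.
move=> Mmod Mi; have [M0 MD MM] := Mmod.
elim: n x => [|n IHn] x xN; first by exists 0 => // -[].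
have [N NM xE0] := xN ord0; rewrite big_ord_recl in xE0.
pose y := N ord0; have My : M y by apply: NM.
pose f := lift ord0 : 'I_n -> 'I_n.+1.
have yx0 : (1 - y) * x ord0 = \sum_(j < n) N (f j) * x (f j).
  by rewrite mulrBl mul1r {1}xE0 addrAC subrr add0r.
have [i|a Ma ax] := IHn (x \o f).
  have [L LM xEi] := xN (f i); rewrite big_ord_recl in xEi.
  exists (fun j => (1 - y) * L (f j) + L ord0 * N (f j) + (if j == i then y else 0)).
    move=> j; apply: (MD); first apply: (MD).
    - by rewrite mulrBl mul1r; apply: bmoduleB => //; apply: MM => //; apply: Mi.
    - by apply: MM => //; apply: Mi.
    - by case: ifP.
  rewrite /= (eq_bigr (fun j => (1 - y) * (L (f j) * x (f j)) +
    L ord0 * (N (f j) * x (f j)) + (if j == i then y * x (f j) else 0))).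
    rewrite 2!big_split /= -!mulr_sumr -yx0 -big_mkcond big_pred1_eq /=.
    by rewrite [in X in _ = _ + X]xEi {1}xEi; ring.
  by move=> j _; case: ifP => _; ring.
have ax0 : (1 - a) * ((1 - y) * x ord0) = 0.
  by rewrite yx0 mulr_sumr big1// => j _; rewrite mulrCA ax mulr0.
exists (a + y - a * y).
  by apply: bmoduleB => //; [apply: MD|apply: MM => //; apply: Mi].
have -> : 1 - (a + y - a * y) = (1 - a) * (1 - y) by ring.
move=> i; case: (unliftP ord0 i) => [j ->|->]; last by rewrite -mulrA.
by rewrite mulrAC ax mul0r.
Qed.

End Fractions.

(** * Infinitely many trace ideals from a regular prime that is not maximal *)

Section TwoPrimes.
Local Open Scope classical_set_scope.
Variable A : comPzRingType.
Notation Q := (total_frac A).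
Notation emb := (@to_frac A).
Implicit Types (I J M : set Q) (x y z : Q).

(** Submodules of the integral closure that are regular ideals of A and satisfy
    A : I = intclos. They are trace ideals of A, as they are stable under
    intclos. *)
Definition colon_integral I := [/\ bmodule I, forall x, I x -> in_base x,
  exists2 s, GRing.lreg s & I (emb s) &
  forall y, (forall x, I x -> in_base (y * x)) -> integral emb y].

Lemma colon_integral_ideal I : colon_integral I -> is_ideal (emb @^-1` I).
Proof.
move=> [[I0 ID IM] _ _ _]; split.
- by rewrite /= rmorph0.
- by move=> a b Ia Ib; rewrite /= rmorphD; apply: ID.
- by move=> a b Ib; rewrite /= rmorphM; apply: IM => //; apply: integral_base.
Qed.

Lemma colon_integral_Tr I : colon_integral I -> Tr A (emb @^-1` I).
Proof.
move=> Icolint; have [[_ _ IM] Ibase [s sreg Is] Icolon] := Icolint.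
apply: (Tr_frac (colon_integral_ideal Icolint) Is sreg) => q qI a Ia.
have [b bE] := qI a Ia; exists b => //; rewrite /= -bE.
apply: IM => //; apply: Icolon => x Ix.
by have [c xE] := Ibase _ Ix; rewrite xE; apply: qI; rewrite /= -xE.
Qed.

(** The conductor C = A : intclos. If y C is contained in A, then in C, so that
    s y^k lies in A for every k and y is integral. *)
Lemma colon_integral_conductor s : noetherian A -> GRing.lreg s ->
  (forall x, integral emb x -> in_base (emb s * x)) ->
  colon_integral [set x | forall b, integral emb b -> in_base (x * b)].
Proof.
move=> noeA sreg sB; split.
- split.
  + by move=> b _; rewrite mul0r -(rmorph0 emb); exists 0.
  + by move=> x y Ix Iy b bi; rewrite mulrDl; apply: in_baseD; [apply: Ix|apply: Iy].
  + move=> c x ci Ix b bi; rewrite mulrC mulrA mulrC.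
    by rewrite [b * c]mulrC; apply: Ix; apply: integralM.
- by move=> x /(_ 1); rewrite mulr1; apply; apply: integral_one.
- by exists s.
- move=> y yI; apply: (almost_integral (s := s) noeA sreg) => k.
  suff sk : forall b, integral emb b -> in_base (emb s * y ^+ k * b).
    by have := sk 1 (integral_one _); rewrite mulr1.
  elim: k => [|k IHk] b bi; first by rewrite expr0 mulr1; apply: sB.
  have -> : emb s * y ^+ k.+1 * b = y * (emb s * y ^+ k * b) by rewrite exprS; ring.
  apply: yI => c ci; rewrite -[_ * b * c]mulrA; apply: IHk; exact: integralM.
Qed.

Section ProductWithM.
Variable M : set Q.
Hypothesis Mmod : bmodule M.
Hypothesis Mint : M `<=` integral emb.
Hypothesis Mreg : exists2 s, GRing.lreg s & M (emb s).
Hypothesis Mcolon :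
  forall y, (forall x, M x -> integral emb (y * x)) -> integral emb y.

Lemma mulmod_subr I : bmodule I -> mulmod M I `<=` I.
Proof.
move=> Imod; apply: mulmod_sub => // y z My Iz.
by case: Imod => _ _; apply => //; apply: Mint.
Qed.

(** A : M I = (A : I) : M = intclos : M = intclos. *)
Lemma colon_integral_mulmod I : colon_integral I -> colon_integral (mulmod M I).
Proof.
move=> [Imod Ibase [s sreg Is] Icolon]; split.
- exact: mulmod_bmodule.
- by move=> x /(mulmod_subr Imod); apply: Ibase.
- have [r rreg Mr] := Mreg; exists (r * s); first exact: GRing.lregM.
  by rewrite rmorphM; apply: mulmod_mul.
- move=> y yMI; apply: Mcolon => x Mx; apply: Icolon => z Iz.
  by rewrite -mulrA; apply: yMI; apply: mulmod_mul.
Qed.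

(** If I = M I, then Nakayama gives an element of 1 + M that annihilates I; it
    is 0 because I contains a regular element, so that M contains 1. *)
Lemma mulmod_proper I : noetherian A -> ~ M 1 -> colon_integral I ->
  exists2 a, I (emb a) & ~ mulmod M I (emb a).
Proof.
move=> noeA M1 Icolint; apply: contrapT => noa.
have IMI x : I x -> mulmod M I x.
  move=> Ix; have [_ Ibase _ _] := Icolint; have [a xE] := Ibase _ Ix.
  by apply: contrapT => nMI; apply: noa; exists a; rewrite -xE.
have [Imod Ibase [s sreg Is] _] := Icolint; have [I0 ID IM] := Imod.
have [M0 MD MM] := Mmod.
have [n [a IE]] := noeA _ (colon_integral_ideal Icolint).
have Ia i : I (emb (a i)) := generator_mem i IE.
have Igen x : I x -> exists c : 'I_n -> A, x = \sum_i emb (c i) * emb (a i).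
  move=> Ix; have [b xE] := Ibase _ Ix.
  have : (emb @^-1` I) b by rewrite /= -xE.
  rewrite IE => -[c bE]; exists c; rewrite xE bE rmorph_sum.
  by apply: eq_bigr => i _; rewrite rmorphM.
have [i|b Mb ba] := @nakayama A M n (fun i => emb (a i)) Mmod Mint.
  have := IMI _ (Ia i).
  pose K x := exists2 N : 'I_n -> Q, (forall j, M (N j)) &
    x = \sum_(j < n) N j * emb (a j).
  move=> /(_ [set x | K x]); apply => /=.
  - by exists (fun=> 0) => //; rewrite big1// => j _; rewrite mul0r.
  - move=> x y [N MN xE] [L ML yE]; exists (fun j => N j + L j).
      by move=> j; apply: MD.
    by rewrite xE yE -big_split; apply: eq_bigr => j _; rewrite mulrDl.
  - move=> x y Mx /Igen[c ->]; exists (fun j => emb (c j) * x).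
      by move=> j; apply: MM => //; apply: integral_base.
    by rewrite mulr_sumr; apply: eq_bigr => j _; ring.
apply: M1; suff -> : 1 = b by [].
apply/eqP; rewrite -subr_eq0; apply/eqP; apply: (frac_regI sreg).
rewrite mulr0 mulrC; have [c ->] := Igen _ Is.
by rewrite mulr_sumr big1// => j _; rewrite mulrCA ba mulr0.
Qed.

End ProductWithM.

(** A descending sequence that never stabilizes is injective. *)
Lemma no_infinite_descent (T : Type) (F : nat -> set T) (X : set (set T)) :
  finite_set X -> (forall n, X (F n)) -> (forall n, F n.+1 `<=` F n) ->
  exists n, F n `<=` F n.+1.
Proof.
move=> /finite_seqP[ss XE] XF Fdec; apply: contrapT => Fproper.
have Fle : {homo F : m n / (m <= n)%N >-> n `<=` m}.
  move=> m n /subnK <-; elim: (n - m)%N => [//|k IHk].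
  by apply: subset_trans IHk; rewrite addSn.
have Finj : injective F.
  suff Fneq m n : (m < n)%N -> F m <> F n.
    move=> m n Fmn; case: (ltngtP m n) => // [/Fneq|/Fneq]; first by case.
    by move=> /(_ (esym Fmn)).
  move=> mn FE; apply: Fproper; exists m; rewrite FE.
  exact: Fle.
have : (size (map F (seq.iota 0 (size ss).+1)) <= size ss)%N.
  apply: uniq_leq_size; first by rewrite map_inj_uniq// iota_uniq.
  by move=> _ /mapP[n _ ->]; have := XF n; rewrite XE.
by rewrite size_map size_iota ltnn.
Qed.

(** Let q lie over P in the integral closure, t in P' but not in P, and
    M = q + t intclos, a proper ideal. If y M is contained in intclos, then
    y q is contained in q: for z in q, the product of y z with t is (t y) z,
    in q, and t is outside the prime q. As q contains a regular element, y is
    almost integral, hence integral. So intclos : M = intclos, and the ideals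
    M^n C, for C the conductor, are pairwise distinct trace ideals. *)
Lemma Tr_infinite (P P' : set A) s :
  noetherian A -> is_prime P -> is_prime P' -> P `<` P' -> GRing.lreg s -> P s -> ~ finite_set (Tr A).
Proof.
move=> noeA Ppr P'pr [PP' P'P] sreg Ps finTr.
have [r rreg rB] := common_denominator finTr.
have [t P't Pt] : exists2 t, P' t & ~ P t.
  apply: contrapT => no; apply: P'P => t P't; apply: contrapT => Pt.
  by apply: no; exists t.
have [q [qmod qint qP qpr]] := lying_over Ppr.
have [q0 qD qM] := qmod; have qs : q (emb s) by apply/qP.
pose M := adjoin q (emb t).
have Mmod : bmodule M by exact: adjoin_bmodule.
have Mint : M `<=` integral emb.
  by apply: adjoin_integral => //; exact: integral_base.
have qsubM : q `<=` M by exact: sub_adjoin.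
have Mt : M (emb t) by exact: adjoin_mem.
have M1 : ~ M 1.
  move=> [b bi]; rewrite -(rmorph1 emb) => /(integral_contract qmod bi).
  move=> [n [c /qP]]; rewrite expr1n => /PP' P'1.
  have [P'id P'n1 _] := P'pr; apply: P'n1; rewrite -(addrK (t * c) 1).
  apply: ideal_sub => //; rewrite mulrC.
  by have [_ _] := P'id; apply.
have Mcolon y : (forall x, M x -> integral emb (y * x)) -> integral emb y.
  move=> yM; have yq z : q z -> q (y * z).
    move=> qz; have [| | |//|/qP//] := qpr (y * z) (emb t).
    - by apply: yM; apply: qsubM.
    - exact: integral_base.
    - by rewrite mulrAC; apply: qM => //; exact: yM.
  apply: (almost_integral (s := r * s) noeA) => [|k]; first exact: GRing.lregM.
  rewrite rmorphM -mulrA; apply: rB; apply: qint.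
  elim: k => [|k IHk]; first by rewrite expr0 mulr1.
  by rewrite exprS mulrCA; apply: yq.
have Mreg : exists2 s, GRing.lreg s & M (emb s) by exists s => //; apply: qsubM.
pose G n := iter n (mulmod M)
  [set x | forall b, integral emb b -> in_base (x * b)].
have Gcolon n : colon_integral (G n).
  elim: n => [|n IHn]; [exact: colon_integral_conductor noeA rreg rB|].
  exact: colon_integral_mulmod.
have [n|n] := no_infinite_descent (F := fun n => emb @^-1` G n) finTr
  (fun n => colon_integral_Tr (Gcolon n)).
  by move=> a; apply: mulmod_subr => //; case: (Gcolon n).
have [a Ga nGa] := mulmod_proper Mmod Mint noeA M1 (Gcolon n).
by move=> /(_ a Ga).
Qed.

End TwoPrimes.

(** * Reduction to a quotient in which a prime is regular *)

Section Quotients.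
Local Open Scope classical_set_scope.
Variable R : comPzRingType.

Lemma quot_noetherian (I : ideal R) : noetherian R -> noetherian (quot_ring I).
Proof.
move=> noeR J [J0 JD JM].
have [|n [a aE]] := noeR (@to_quot R I @^-1` J).
  split; first by rewrite /= rmorph0.
  - by move=> x y Jx Jy; rewrite /= rmorphD; apply: JD.
  - by move=> b x Jx; rewrite /= rmorphM; apply: JM.
exists n, (fun i => to_quot I (a i)); apply/seteqP; split=> [u|u [c ->]].
  have [x <-] := to_quot_surj u => Jx.
  have : (@to_quot R I @^-1` J) x by [].
  rewrite aE => -[c ->]; exists (fun i => to_quot I (c i)).
  by rewrite rmorph_sum; apply: eq_bigr => i _; rewrite rmorphM.
apply: ideal_sum => // i.
exact: (generator_mem i aE).
Qed.

Lemma quot_prime (I : ideal R) (P' : set R) :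
  is_prime P' -> ideal_set I `<=` P' ->
  is_prime (@to_quot R I @` P') /\
  forall x, (@to_quot R I @` P') (to_quot I x) <-> P' x.
Proof.
move=> [P'id P'1 P'mul] IP'; have [P'0 P'D P'M] := P'id.
have mem x : (@to_quot R I @` P') (to_quot I x) <-> P' x.
  split=> [[y P'y /to_quot_eq /IP' yx]|P'x]; last by exists x.
  by rewrite -(subKr y x); apply: ideal_sub.
split=> //; split.
- split; first by exists 0; rewrite ?rmorph0.
  + by move=> _ _ [x Px <-] [y Py <-]; rewrite -rmorphD; apply/mem/P'D.
  + move=> a _ [x Px <-]; have [b <-] := to_quot_surj a.
    by rewrite -rmorphM; apply/mem/P'M.
- by rewrite -(rmorph1 (@to_quot R I)) => /mem.
- move=> u v; have [x <-] := to_quot_surj u; have [y <-] := to_quot_surj v.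
  by rewrite -rmorphM => /mem/P'mul[?|?]; [left|right]; apply/mem.
Qed.

End Quotients.

Section Kernel.
Local Open Scope classical_set_scope.
Variables (R : comPzRingType) (P : set R).
Hypothesis Ppr : is_prime P.

(** The kernel of the localization of R at P. *)
Definition loc_kernel : set R := [set x | exists2 s, ~ P s & s * x = 0].

Lemma loc_kernel_is_ideal : is_ideal loc_kernel.
Proof.
have [_ P1 Pmul] := Ppr; split.
- by exists 1; rewrite ?mulr0.
- move=> x y [s Ps sx] [t Pt ty]; exists (s * t); first by case/Pmul.
  by rewrite mulrDr mulrAC sx mul0r add0r -mulrA ty mulr0.
- by move=> a x [s Ps sx]; exists s => //; rewrite mulrCA sx mulr0.
Qed.

Definition loc_kernel_ideal := Ideal loc_kernel_is_ideal.
Notation S := (quot_ring loc_kernel_ideal).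
Notation pi := (@to_quot R loc_kernel_ideal).

Lemma loc_kernel_sub : loc_kernel `<=` P.
Proof.
have [[P0 _ _] _ Pmul] := Ppr => x [s Ps sx].
by have [] := Pmul s x; rewrite ?sx.
Qed.

Lemma to_quot_lreg x : ~ P x -> GRing.lreg (pi x).
Proof.
move=> Px u v; have [a <-] := to_quot_surj u; have [b <-] := to_quot_surj v.
rewrite -!rmorphM => /to_quot_eq[s Ps sx]; apply/to_quot_eq.
have [_ _ Pmul] := Ppr; exists (s * x); first by case/Pmul.
by rewrite -mulrA mulrBr.
Qed.

(** A homomorphism g from the preimage of I to R descends to a homomorphism from
    I to the quotient: a kernel element is annihilated by some s outside P, so
    its image under g is annihilated by s too. *)
Lemma Tr_preimage (I : set S) : Tr S I -> Tr R (pi @^-1` I).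
Proof.
move=> /TrP[[I0 ID IM] Ist].
have I'id : is_ideal (pi @^-1` I).
  split; first by rewrite /= rmorph0.
  - by move=> x y Ix Iy; rewrite /= rmorphD; apply: ID.
  - by move=> b x Ix; rewrite /= rmorphM; apply: IM.
apply/TrP; split=> // g gl x Ix.
have gker y z : I (pi y) -> I (pi z) -> pi y = pi z -> pi (g y) = pi (g z).
  move=> Iy Iz /to_quot_eq[s Ps s0]; apply/to_quot_eq; exists s => //.
  rewrite -(linear_onB I'id gl Iy Iz) -(linear_onM _ I'id gl); last first.
    by rewrite /= rmorphB; apply: (@ideal_sub _ I).
  by rewrite s0 (linear_on0 I'id gl).
pose h (u : S) : S := pi (g (quot_repr u)).
have hE y : I (pi y) -> h (pi y) = pi (g y).
  by move=> Iy; apply: gker; rewrite ?quot_reprK.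
rewrite /= -hE//; apply: Ist => // a u v.
have [b <-] := to_quot_surj a; have [y <-] := to_quot_surj u.
have [z <-] := to_quot_surj v => Iy Iz.
rewrite -rmorphM -rmorphD !hE//=; last by rewrite rmorphD rmorphM; apply/ID/Iz/IM.
by rewrite gl// rmorphD rmorphM.
Qed.

Lemma Tr_quot_finite : finite_set (Tr R) -> finite_set (Tr S).
Proof.
move=> finTr; apply: (@sub_finite_set _ _ (image^~ pi @` Tr R)).
  move=> I TrI; exists (pi @^-1` I); first exact: Tr_preimage.
  apply/seteqP; split=> [_ [x Ix <-]//|u Iu].
  by have [x xu] := to_quot_surj u; exists x => //; rewrite /= xu.
exact: finite_image.
Qed.

End Kernel.

(** For a chain p0 < p1 < p2, pass to the image of R in its localization at p0.
    There p1 contains a regular element, namely the class of any element of p1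
    outside p0, and p2 is strictly larger. *)
Lemma Tr_finite_dim (R : comPzRingType) : noetherian R -> finite_set (Tr R) ->
  (krull_dim R <= 1%:E)%E.
Proof.
move=> noeR finTr; apply/nat_sup_leP => n [p [ppr plt]].
rewrite leNgt; apply/negP; rewrite lte_fin ltz_nat => n2.
pose i0 : 'I_n.+1 := ord0.
pose i1 : 'I_n.+1 := inord 1; pose i2 : 'I_n.+1 := inord 2.
have p01 : (p i0 `<` p i1)%classic by apply: plt; rewrite /= inordK// ltnS ltnW.
have p12 : (p i1 `<` p i2)%classic.
  by apply: plt; rewrite /= !inordK// ltnS ltnW.
have [x p1x p0x] : exists2 x, p i1 x & ~ p i0 x.
  have [_ n10] := p01; apply: contrapT => no; apply: n10 => x p1x.
  by apply: contrapT => p0x; apply: no; exists x.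
have ker_sub := loc_kernel_sub (ppr i0).
have [s1 m1] := @quot_prime R (loc_kernel_ideal (ppr i0)) _ (ppr i1)
  (subset_trans ker_sub p01.1).
have [s2 m2] := @quot_prime R (loc_kernel_ideal (ppr i0)) _ (ppr i2)
  (subset_trans ker_sub (subset_trans p01.1 p12.1)).
have := Tr_quot_finite (ppr i0) finTr.
apply: (Tr_infinite _ s1 s2 _ (to_quot_lreg p0x)).
- exact: quot_noetherian.
- split=> [_ [y p1y <-]|le]; first by apply/m2; exact: p12.1.
  by apply: p12.2 => y p2y; apply/m1/le/m2.
- exact/m1.
Qed.

Unset Implicit Arguments.

Theorem theorem2p6 (R : comNzRingType) (m : set R) :
  noetherian R -> is_local m -> finite_set (Tr R) ->
  ((krull_dim R <= 2%:E)%E /\ module_finite (@to_intclos R)) /\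
  (equidimensional (intclos (quot_ring (torsion m))) ->
   (krull_dim R <= 1%:E)%E).
Proof.
move=> noeR _ finTr; have dim1 := Tr_finite_dim noeR finTr.
split=> //; split; last exact: intclos_module_finite.
by apply: le_trans dim1 _; rewrite lee_fin.
Qed.
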